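(* Let $n\ge 1$ and $\lambda>0$, and let $\sigma:\mathbb{R}^n\to\mathbb{R}^n$, $\sigma_i(z) = \frac{\exp(\lambda z_i)}{\sum_{j=1}^n\exp(\lambda z_j)}$ for $1\le i\le n$, be the softmax function with inverse temperature constant $\lambda$. Then $\sigma$ is $\frac{1}{L}$-co-coercive with respect to $\|\cdot\|_2$ with $L=\lambda$, that is, for all $z,z'\in\mathbb{R}^n$, $$(\sigma(z)-\sigma(z'))^\top(z-z')\ge\frac{1}{\lambda}\|\sigma(z)-\sigma(z')\|_2^2.$$
   Context: $\|\cdot\|_2$ denotes the Euclidean norm on $\mathbb{R}^n$. *)

(* Defs.v *)
From mathcomp Require Import all_boot all_order all_algebra.
From mathcomp Require Import reals sequences exp.

Set Implicit Arguments.
Unset Strict Implicit.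
Unset Printing Implicit Defensive.

Import Order.TTheory GRing.Theory Num.Theory.

Local Open Scope ring_scope.

Definition softmax (R : realType) (n : nat) (lambda : R) (z : 'cV[R]_n) :
    'cV[R]_n :=
  \col_(i < n) (expR (lambda * z i 0) / \sum_(j < n) expR (lambda * z j 0)).

(* The library's norm `|v| on matrices is the sup norm, hence this definition. *)
Definition norm2 (R : realType) (n : nat) (v : 'cV[R]_n) : R :=
  Num.sqrt (\sum_(i < n) v i 0 ^+ 2).

(* f is mu-co-coercive with respect to the norm N; the indices 0 0 extract the
   scalar from the 1 x 1 matrix u^T v. *)
Definition cocoercive (R : realType) (n : nat) (N : 'cV[R]_n -> R) (mu : R)
    (f : 'cV[R]_n -> 'cV[R]_n) : Prop :=
  forall z z' : 'cV[R]_n,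
    ((f z - f z')^T *m (z - z')) 0 0 >= mu * N (f z - f z') ^+ 2.

(* Main.v *)
Require Import Defs.
From mathcomp Require Import all_boot all_order all_algebra.
From mathcomp Require Import reals sequences exp.
From mathcomp Require Import ring lra.

Set Implicit Arguments.
Unset Strict Implicit.
Unset Printing Implicit Defensive.

Import Order.TTheory GRing.Theory Num.Theory.

Local Open Scope ring_scope.

(** Write [p = softmax lambda z] and [q = softmax lambda z'].  The logarithm of
    a softmax is an affine function of its argument up to one scalar:
    [ln p_i = lambda * z_i - A z], where [A] is the log-sum-exp function
    ([logit_softmax]).  Since [p] and [q] both have total mass [1], the vector
    [p - q] is orthogonal to constants, so the two scalars disappear from
    [lambda * (p - q)^T (z - z') = \sum_i (p_i - q_i) * (ln p_i - ln q_i)].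
    The right-hand side dominates [\sum_i (p_i - q_i)^2] term by term, because
    all [p_i] and [q_i] are at most [1], where the slope of [ln] is at least
    [1]; equivalently, [expR] is 1-co-coercive on the nonpositive half-line
    ([expR_cocoercive]).  Working coordinate by coordinate in this way replaces
    the usual bound on the Hessian of log-sum-exp. *)

(** Convexity of [expR] bounds the difference quotient by the slope at the
    larger argument, which is at most [1] for nonpositive arguments. *)
Lemma expR_cocoercive (R : realType) (a b : R) : a <= 0 -> b <= 0 ->
  (expR a - expR b) ^+ 2 <= (expR a - expR b) * (a - b).
Proof.
wlog le_ba : a b / b <= a => [hwlog a0 b0|a0 _].
  have [le_ba|/ltW le_ab] := leP b a; first exact: hwlog.
  by have := hwlog b a le_ab b0 a0; rewrite -!(opprB b) -(opprB (expR b)) sqrrN mulrNN.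
rewrite expr2 ler_wpM2l ?subr_ge0 ?ler_expR//.
(* The tangent to the exponential at [a] lies below its value at [b]. *)
have tangent : expR a * (1 + (b - a)) <= expR b.
  rewrite -{2}(subrK a b) expRD mulrC ler_wpM2r ?expR_ge0//.
  exact: expR_ge1Dx.
have le1 : expR a * (a - b) <= 1 * (a - b).
  by rewrite ler_wpM2r ?subr_ge0// -expR0 ler_expR.
lra.
Qed.

Section Softmax.
Variables (R : realType) (n : nat) (lambda : R).
Implicit Types (z : 'cV[R]_n) (i : 'I_n).

Definition partition_function z : R := \sum_(j < n) expR (lambda * z j 0).

Lemma partition_function_gt0 z : (0 < n)%N -> 0 < partition_function z.
Proof.
move=> n_gt0; rewrite /partition_function (bigD1 (Ordinal n_gt0))//=.
by rewrite ltr_pwDl ?expR_gt0// sumr_ge0// => j _; exact: expR_ge0.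
Qed.

Lemma sum_softmax z : (0 < n)%N -> \sum_(i < n) softmax lambda z i 0 = 1.
Proof.
move=> n_gt0; under eq_bigr do rewrite mxE.
by rewrite -mulr_suml mulfV// gt_eqF// partition_function_gt0.
Qed.

Definition logit z i : R := lambda * z i 0 - ln (partition_function z).

Lemma logit_softmax z i : softmax lambda z i 0 = expR (logit z i).
Proof.
have n_gt0 : (0 < n)%N by exact: leq_ltn_trans (ltn_ord i).
by rewrite mxE expRB lnK// posrE partition_function_gt0.
Qed.

(** Each softmax coordinate is at most the total mass [1]. *)
Lemma logit_le0 z i : logit z i <= 0.
Proof.
have n_gt0 : (0 < n)%N by exact: leq_ltn_trans (ltn_ord i).
rewrite -ler_expR expR0 -logit_softmax -(sum_softmax z n_gt0) (bigD1 i)//=.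
by rewrite lerDl sumr_ge0// => j _; rewrite logit_softmax expR_ge0.
Qed.

(** The normalizing constants are paired with a difference of two vectors of
    equal mass, hence contribute nothing. *)
Lemma sum_softmaxB_logitB z z' : (0 < n)%N ->
  \sum_(i < n) (softmax lambda z i 0 - softmax lambda z' i 0) *
               (logit z i - logit z' i) =
  lambda * \sum_(i < n) (softmax lambda z i 0 - softmax lambda z' i 0) *
                        (z i 0 - z' i 0).
Proof.
move=> n_gt0.
set c := ln (partition_function z) - ln (partition_function z').
have mass0 : \sum_(i < n) (softmax lambda z i 0 - softmax lambda z' i 0) = 0.
  by rewrite sumrB !sum_softmax// subrr.
rewrite -[RHS]subr0 -[X in _ - X](mul0r c) -[X in X * c]mass0.
rewrite mulr_suml mulr_sumr -sumrB.
by apply: eq_bigr => i _; rewrite /logit /c; ring.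
Qed.

End Softmax.

Lemma sqr_norm2 (R : realType) (n : nat) (v : 'cV[R]_n) :
  norm2 v ^+ 2 = \sum_(i < n) v i 0 ^+ 2.
Proof. by rewrite sqr_sqrtr// sumr_ge0// => i _; exact: sqr_ge0. Qed.

Theorem corollary2 (R : realType) (n : nat) (lambda : R)
    (n_ge1 : (1 <= n)%N) (lambda_gt0 : 0 < lambda) :
  cocoercive (@norm2 R n) (1 / lambda) (softmax lambda).
Proof.
move=> z z'; rewrite mul1r ler_pdivrMl// sqr_norm2 mxE.
have -> : \sum_(i < n) (softmax lambda z - softmax lambda z')^T 0 i *
                       (z - z') i 0 =
          \sum_(i < n) (softmax lambda z i 0 - softmax lambda z' i 0) *
                       (z i 0 - z' i 0).
  by apply: eq_bigr => i _; rewrite !mxE.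
rewrite -sum_softmaxB_logitB//; apply: ler_sum => i _.
have -> : (softmax lambda z - softmax lambda z') i 0 =
          softmax lambda z i 0 - softmax lambda z' i 0 by rewrite !mxE.
by rewrite !logit_softmax; apply: expR_cocoercive; exact: logit_le0.
Qed.
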